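(* If $G$ is a diamond-free, claw-free cubic graph, then $G$ is $(1,1,2,3)$-packing colorable.
   Context: Graphs are finite, simple and undirected. A graph is cubic if every vertex has degree $3$. A graph is claw-free if it has no induced subgraph isomorphic to $K_{1,3}$. The diamond is the graph obtained from $K_4$ by deleting one edge; a graph is diamond-free if it has no induced subgraph isomorphic to the diamond (so $K_4$ itself is diamond-free). The distance $\mathrm{dist}(u,v)$ between two vertices is the minimum length of a path between them (infinite if there is no such path). For a positive integer $i$, a set $A\subseteq V(G)$ is an $i$-packing if $\mathrm{dist}(u,v)>i$ for every pair of distinct vertices $u,v\in A$; a $1$-packing is the same as an independent set. A $(1,1,2,3)$-packing coloring of $G$ is a partition $V(G)=A\cup B\cup C\cup D$ (parts may be empty) such that $A$ and $B$ are independent sets, $C$ is a $2$-packing and $D$ is a $3$-packing in $G$. $G$ is $(1,1,2,3)$-packing colorable if it has such a coloring. *)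

(* Defs.v *)
From mathcomp Require Import all_boot.

Set Implicit Arguments.
Unset Strict Implicit.
Unset Printing Implicit Defensive.

(* A finite simple graph is given by its vertex type T : finType and its
   adjacency relation e : rel T, assumed symmetric and irreflexive wherever
   these definitions are used. *)

Definition cubic (T : finType) (e : rel T) : Prop :=
  forall x : T, #|[set y | e x y]| = 3.

Definition graph_iso (U V : finType) (h : rel U) (e : rel V) : Prop :=
  exists2 f : U -> V, bijective f & forall x y, e (f x) (f y) = h x y.

Definition induced (T : finType) (e : rel T) (S : {set T}) :
    rel {x : T | x \in S} :=
  fun x y => e (val x) (val y).

Definition induced_free (U T : finType) (h : rel U) (e : rel T) : Prop :=
  ~ exists S : {set T}, graph_iso h (@induced T e S).

(* K_{1,3} with center 0. *)
Definition claw : rel 'I_4 :=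
  fun i j => (i != j) && ((val i == 0) || (val j == 0)).

(* K_4 minus the edge {0, 1}. *)
Definition diamond : rel 'I_4 :=
  fun i j => (i != j) && ~~ ((val i <= 1) && (val j <= 1)).

Definition claw_free (T : finType) (e : rel T) : Prop := induced_free claw e.

Definition diamond_free (T : finType) (e : rel T) : Prop :=
  induced_free diamond e.

Definition path_of_length (T : finType) (e : rel T) (u v : T) (n : nat) : bool :=
  [exists p : n.-tuple T, [&& path e u p, uniq (u :: p) & last u p == v]].

(* None stands for an infinite distance; since paths do not repeat vertices,
   only lengths below #|T| need to be searched. *)
Definition dist (T : finType) (e : rel T) (u v : T) : option nat :=
  ohead [seq n <- iota 0 #|T| | path_of_length e u v n].

Definition dist_gt (d : option nat) (i : nat) : bool :=
  if d is Some n then i < n else true.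

Definition independent (T : finType) (e : rel T) (A : {set T}) : Prop :=
  {in A &, forall u v, ~~ e u v}.

Definition packing (T : finType) (e : rel T) (i : nat) (A : {set T}) : Prop :=
  {in A &, forall u v, u != v -> dist_gt (dist e u v) i}.

(* MathComp's partition predicate excludes empty parts, so the partition is
   spelled out. *)
Definition partition4 (T : finType) (A B C D : {set T}) : Prop :=
  A :|: B :|: C :|: D = [set: T] /\
  [/\ [disjoint A & B], [disjoint A & C] & [disjoint A & D]] /\
  [/\ [disjoint B & C], [disjoint B & D] & [disjoint C & D]].

Definition packing_colorable_1123 (T : finType) (e : rel T) : Prop :=
  exists A B C D : {set T},
    partition4 A B C D /\
    [/\ independent e A, independent e B, packing e 2 C & packing e 3 D].

(* Main.v *)
Require Import Defs.
From mathcomp Require Import all_boot.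

(** The edges at a vertex [x] of a claw-free cubic graph are not independent,
    so [x] lies in a triangle; without induced diamonds, two triangles that
    share an edge generate a [K_4].  Hence the vertices split into blocks, each
    a triangle or a [K_4] ([same_block_trans], [card_block_ge3]), and since
    [x] has degree 3, it has exactly one neighbour outside its block when the
    block is a triangle and none when it is a [K_4] ([card_block_out]).  The
    outside edges form a matching, and contracting the blocks gives a cubic
    multigraph [H] (plus isolated vertices, from the [K_4]).

    Two observations reduce the problem to [H].  First, suppose that all but
    two vertices of every block have been coloured with [C] and [D].  What is
    left has its edges in two matchings, the edges inside blocks and the edges
    between blocks; a cycle alternates between them, hence is even, and the
    rest can be coloured with [A] and [B] ([two_matchings_2colorable]).  So it
    suffices to point out one vertex in every triangle, or equivalently to let
    every vertex of [H] point along one of its edges, and to point out two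
    vertices in every [K_4].  Second, distances between pointing vertices can
    be read in [H]: those of distinct blocks are at distance at most 2 only
    if one of them points to the block of the other, and at distance at most 3
    only if their blocks are adjacent or they point to the same block.

    Now let [I] be a maximal independent set of [H].  Every vertex of [H]
    outside [I] has a neighbour in [I]: let it point there, and put its
    pointing vertex in [C].  Blocks outside [I] never point to one another, so
    [C] is a 2-packing ([C_packing]).  The blocks in [I] are pairwise
    nonadjacent, so their pointing vertices, which make up [D], form a
    3-packing as soon as no two of them point to the same block ([D_packing]).
    Such a choice is a system of distinct representatives; as a family [A] of
    triangles in [I] sends out [3 * #|A|] edges and each triangle receives at
    most 3 of them, it exists by Hall's theorem ([pointing_vertices]).  A
    [K_4] belongs to [I] by maximality, and gives one vertex to [D] and one to
    [C]. *)

Set Implicit Arguments.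
Unset Strict Implicit.
Unset Printing Implicit Defensive.

(** * Systems of distinct representatives *)

(** Rado's proof of Hall's theorem: shrink the sets [F i] as long as the
    condition survives, until each is a singleton.  If removing [y1] and
    removing [y2] from the same [F i] both broke it, on index sets [i |: A1]
    and [i |: A2], then counting over unions and intersections would
    contradict it for [i |: (A1 :|: A2)] or [A1 :&: A2].  Representatives are options because [Y] may be empty when
    [X] is. *)
Lemma Hall_marriage (I Y : finType) (X : {set I}) (F : I -> {set Y}) :
  (forall A : {set I}, A \subset X -> #|A| <= #|\bigcup_(i in A) F i|) ->
  exists2 f : I -> option Y,
    {in X, forall i, exists2 y, f i = Some y & y \in F i} &
    {in X &, injective f}.
Proof.
have [n] := ubnP (\sum_(i in X) #|F i|).
elim: n F => // n IHn F leFn hallF.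
have F_gt0 i : i \in X -> 0 < #|F i|.
  by move=> Xi; have := hallF [set i]; rewrite sub1set big_set1 cards1; apply.
have [/forall_inP F1|] := boolP [forall i in X, #|F i| <= 1].
  exists (fun i => [pick y in F i]) => [i Xi|i j Xi Xj].
    case: pickP => [y Fy|F0]; first by exists y.
    by have := F_gt0 i Xi; rewrite (eq_card0 F0).
  case: pickP => [y Fiy|F0]; last by have := F_gt0 i Xi; rewrite (eq_card0 F0).
  case: pickP => // z Fjz [eq_yz]; apply/eqP; apply/idPn => neq_ij.
  have := hallF [set i; j]; rewrite subUset !sub1set Xi Xj cards2 neq_ij.
  move=> /(_ isT).
  have sub1 k w : k \in X -> w \in F k -> F k = [set w].
    move=> Xk Fkw; apply/eqP; rewrite eq_sym eqEcard sub1set Fkw cards1.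
    exact: F1.
  rewrite bigcup_setU !big_set1 (sub1 _ _ Xi Fiy) (sub1 _ _ Xj Fjz) eq_yz.
  by rewrite setUid cards1.
rewrite negb_forall_in => /exists_inP[i Xi]; rewrite -ltnNge => /card_gt1P.
move=> [y1 [y2 [Fy1 Fy2 neq_y]]].
pose Fdel y j := if j == i then F i :\ y else F j.
have subF y j : Fdel y j \subset F j.
  by rewrite /Fdel; case: eqP => [->|]; rewrite ?subD1set.
have reduce y : y \in F i ->
    (forall A : {set I}, A \subset X -> #|A| <= #|\bigcup_(j in A) Fdel y j|) ->
    exists2 f : I -> option Y,
    {in X, forall i, exists2 y, f i = Some y & y \in F i} &
    {in X &, injective f}.
  move=> Fy /IHn[|f fF f_inj].
    rewrite (bigD1 i) //=; move: leFn; rewrite (bigD1 i) //= /Fdel eqxx.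
    rewrite [#|F i|](cardsD1 y) Fy add1n addSn ltnS; apply: leq_trans.
    by rewrite ltnS leq_add2l leq_sum // => j /andP[_ /negPf->].
  exists f => // j /fF[z fj Fz]; exists z => //; exact: subsetP (subF y j) _ Fz.
have bad y : y \in F i ->
    ~~ [forall (A : {set I} | A \subset X),
          #|A| <= #|\bigcup_(j in A) Fdel y j|] ->
    exists2 A : {set I}, (A \subset X) && (i \notin A) &
      #|(F i :\ y) :|: \bigcup_(j in A) F j| <= #|A|.
  move=> Fy; rewrite negb_forall_in => /exists_inP[A sAX]; rewrite -ltnNge => ltA.
  have Ai : i \in A.
    apply: contraLR ltA => nAi; rewrite -leqNgt (leq_trans (hallF A sAX)) //.
    rewrite subset_leq_card //; apply/bigcupsP => j Aj.
    apply: (bigcup_max j) => //; rewrite /Fdel; case: eqP => // eji.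
    by rewrite -eji Aj in nAi.
  exists (A :\ i); first by rewrite !inE eqxx (subset_trans (subD1set _ _)).
  rewrite -ltnS; move: ltA; rewrite (cardsD1 i) Ai add1n; apply: leq_ltn_trans.
  rewrite subset_leq_card // subUset; apply/andP; split.
    by apply: (bigcup_max i) => //; rewrite /Fdel eqxx.
  apply/bigcupsP => j; rewrite !inE => /andP[neq Aj].
  by apply: (bigcup_max j) => //; rewrite /Fdel (negPf neq).
have [/forall_inP/(reduce _ Fy1)//|/bad-/(_ Fy1)[A1 /andP[sA1 iA1] leA1]] :=
  boolP [forall (A : {set I} | A \subset X),
           #|A| <= #|\bigcup_(j in A) Fdel y1 j|].
have [/forall_inP/(reduce _ Fy2)//|/bad-/(_ Fy2)[A2 /andP[sA2 iA2] leA2]] :=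
  boolP [forall (A : {set I} | A \subset X),
           #|A| <= #|\bigcup_(j in A) Fdel y2 j|].
have := leq_add leA1 leA2; rewrite leqNgt => /negP[].
(* submodularity: the two bad unions together cover [F i] *)
rewrite -cardsUI -[X in _ < X]cardsUI -addSn leq_add //.
  have -> : #|A1 :|: A2|.+1 = #|i |: (A1 :|: A2)|.
    by rewrite cardsU1 inE negb_or iA1 iA2.
  apply: leq_trans (hallF _ _) _; first by rewrite !subUset sub1set Xi sA1.
  rewrite subset_leq_card // !bigcup_setU big_set1 setUACA setUSS //.
  apply/subsetP => y Fy; rewrite !inE Fy !andbT.
  by case: eqP => //= ->.
apply: leq_trans (hallF _ (subset_trans (subsetIl _ _) sA1)) _.
rewrite subset_leq_card //; apply/bigcupsP => j; rewrite inE => /andP[A1j A2j].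
rewrite subsetI; apply/andP; split; apply: subset_trans (subsetUr _ _).
  exact: (bigcup_max j).
exact: (bigcup_max j).
Qed.

(** * Two-colouring a union of two matchings *)

(** The orbits of [a \o b] split every orbit of the dihedral group generated by
    [a] and [b] into two halves that both [a] and [b] exchange: an element of
    that group of the form [(a \o b) ^ n \o a] is conjugate to [a] or [b], so
    it has no fixed point.  The colour of a point tells which of the two halves
    contains it, the halves being ordered by a representative. *)
Lemma involutions_2colorable (T : finType) (a b : T -> T) :
  involutive a -> involutive b -> (forall x, a x != x) -> (forall x, b x != x) ->
  exists A : {set T}, forall x,
    (a x \in A) = (x \notin A) /\ (b x \in A) = (x \notin A).
Proof.
move=> aK bK a_free b_free; pose s x := a (b x).
have s_inj : injective s by apply: inj_comp; apply: can_inj; eassumption.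
(* peeling one [s] off each end reduces [n] by 2 *)
have s_neq n x : iter n s x != a x.
  have [m] := ubnP n; elim: m n x => // m IHm [|[|n]] x ltn /=.
  - by rewrite eq_sym.
  - by rewrite (inj_eq (can_inj aK)).
  - rewrite /s (inj_eq (can_inj aK)) -/(s _) -(inj_eq (can_inj bK)) bK.
    rewrite -[s (iter n s x)]iterS iterSr -[X in _ != X]aK.
    by rewrite -/(s x) IHm // -ltnS ltnW.
have rs x : froot s (s x) = froot s x.
  by apply/esym/rootP; [apply: fconnect_sym | apply: fconnect1].
have rb x : froot s (b x) = froot s (a x) by rewrite -rs /s bK.
have ra x : froot s (a x) != froot s x.
  apply/eqP=> /esym/(rootP (fconnect_sym s_inj))/iter_findex/eqP.
  by apply/negP.
exists [set x | enum_rank (froot s x) < enum_rank (froot s (a x))] => x.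
have swap y : froot s y = froot s (a x) -> froot s (a y) = froot s x ->
  (y \in [set x | enum_rank (froot s x) < enum_rank (froot s (a x))]) =
  (x \notin [set x | enum_rank (froot s x) < enum_rank (froot s (a x))]).
  move=> ey eay; rewrite !inE ey eay -leqNgt ltn_neqAle.
  by rewrite (inj_eq val_inj) (inj_eq enum_rank_inj) ra.
by split; apply: swap; rewrite ?aK ?rb // -/(s x) rs.
Qed.

(** A matching is an involution whose fixed points are the unmatched vertices.
    Joining each unmatched vertex to its own copy in [T * bool] makes it
    fixed-point free. *)
Lemma two_matchings_2colorable (T : finType) (p q : rel T) :
  symmetric p -> symmetric q -> irreflexive p -> irreflexive q ->
  (forall x y z, p x y -> p x z -> y = z) ->
  (forall x y z, q x y -> q x z -> y = z) ->
  exists A : {set T}, forall x y, p x y || q x y -> (y \in A) = (x \notin A).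
Proof.
move=> p_sym q_sym p_irr q_irr p_uniq q_uniq.
pose partner (r : rel T) (u : T * bool) :=
  if [pick y | r u.1 y] is Some y then (y, u.2) else (u.1, ~~ u.2).
have partnerE (r : rel T) : (forall x y z, r x y -> r x z -> y = z) ->
    forall x y c, r x y -> partner r (x, c) = (y, c).
  move=> r_uniq x y c rxy; rewrite /partner /=.
  by case: pickP => [z /r_uniq/(_ rxy)-> //|/(_ y)]; rewrite rxy.
have partnerK (r : rel T) : symmetric r ->
    (forall x y z, r x y -> r x z -> y = z) -> involutive (partner r).
  move=> r_sym r_uniq [x c]; rewrite {2}/partner; case: pickP => [y /= rxy|r0].
    by apply: partnerE; rewrite // r_sym.
  by rewrite /partner /=; case: pickP => [y|_]; rewrite ?r0 ?negbK.
have partner_neq (r : rel T) : irreflexive r -> forall u, partner r u != u.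
  move=> r_irr [x c]; rewrite /partner; case: pickP => [y /= rxy|_].
    by apply: contraTneq rxy => -[->]; rewrite r_irr.
  by rewrite xpair_eqE; case: (c); rewrite andbF.
have [|||| A hA] := @involutions_2colorable _ (partner p) (partner q); auto.
exists [set x | (x, false) \in A] => x y; rewrite !inE.
have [hp hq] := hA (x, false).
by case/orP => [/partnerE<-|/partnerE<-].
Qed.

(** * Packings and induced subgraphs *)

Lemma dist_gtW (T : finType) (e : rel T) u v i :
  (forall p, path e u p -> last u p = v -> i < size p) -> dist_gt (dist e u v) i.
Proof.
move=> h; rewrite /dist.
case def_s: [seq n <- _ | _] => [|n s] //=.
have: n \in [seq n <- iota 0 #|T| | path_of_length e u v n].
  by rewrite def_s mem_head.
rewrite mem_filter => /andP[/existsP[p /and3P[up _ /eqP lp]] _].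
by have := h _ up lp; rewrite size_tuple.
Qed.

Lemma packing2I (T : finType) (e : rel T) (A : {set T}) :
  (forall u v, u \in A -> v \in A -> u != v ->
    ~~ e u v /\ forall z, e u z -> ~~ e z v) -> packing e 2 A.
Proof.
move=> h u v Au Av uv; have [h1 h2] := h u v Au Av uv.
apply: dist_gtW => -[|x [|y [|? ?]]] //=
  => [_ /eqP|/andP[uv1 _] eq|/and3P[ux xy _] eq].
- by rewrite (negPf uv).
- by rewrite -eq uv1 in h1.
- by have := h2 x ux; rewrite -eq xy.
Qed.

Lemma packing3I (T : finType) (e : rel T) (A : {set T}) :
  (forall u v, u \in A -> v \in A -> u != v ->
    [/\ ~~ e u v, forall z, e u z -> ~~ e z v &
        forall z w, e u z -> e z w -> ~~ e w v]) -> packing e 3 A.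
Proof.
move=> h u v Au Av uv; have [h1 h2 h3] := h u v Au Av uv.
apply: dist_gtW => -[|x [|y [|z [|? ?]]]] //=
  => [_ /eqP|/andP[uv1 _] eq|/and3P[ux xy _] eq|/and4P[ux xy yz _] eq].
- by rewrite (negPf uv).
- by rewrite -eq uv1 in h1.
- by have := h2 x ux; rewrite -eq xy.
- by have := h3 x y ux xy; rewrite -eq yz.
Qed.

Lemma partition4_split (T : finType) (A C D : {set T}) :
  [disjoint C & D] ->
  partition4 (A :\: (C :|: D)) (~: A :\: (C :|: D)) C D.
Proof.
move=> disCD.
have disD (B X : {set T}) : X \subset C :|: D -> [disjoint B :\: (C :|: D) & X].
  by move=> sX; rewrite disjoints_subset setDE subIset // setCS sX orbT.
split; first by rewrite -setUA -setDUl setUCr setTD setUC setUCr.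
split; split=> //; try by apply: disD; rewrite ?subsetUl ?subsetUr.
by rewrite disjoints_subset !setDE setCI setCK subIset // subsetUl.
Qed.

Lemma induced_free_embedding n (h : rel 'I_n) (T : finType) (e : rel T)
    (f : 'I_n -> T) :
  induced_free h e -> injective f -> ~ (forall i j, e (f i) (f j) = h i j).
Proof.
move=> hfree f_inj fh; apply: hfree; exists (f @: setT).
have fS i : f i \in f @: setT by apply: imset_f.
exists (fun i => exist _ (f i) (fS i)) => [|i j]; last exact: fh.
apply: inj_card_bij => [i j [] /f_inj //|].
by rewrite card_sig card_imset // cardsT.
Qed.

(** * The blocks of a claw-free, diamond-free cubic graph *)

Section ClawDiamondFreeCubic.

Context (T : finType) (e : rel T).
Context (e_sym : symmetric e) (e_irrefl : irreflexive e).
Context (e_cubic : cubic e) (e_claw_free : claw_free e).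
Context (e_diamond_free : diamond_free e).

Let e_neq x y : e x y -> x != y.
Proof. by apply: contraTneq => ->; rewrite e_irrefl. Qed.

Lemma neighbours_adjacent x a b c :
  e x a -> e x b -> e x c -> uniq [:: a; b; c] ->
  [|| e a b, e a c | e b c].
Proof.
move=> xa xb xc /= /and3P[]; rewrite !inE negb_or => /andP[ab ac] bc _.
apply/negPn/negP; rewrite !negb_or => /and3P[nab nac nbc].
have u : uniq [:: x; a; b; c].
  by rewrite /= !inE !negb_or ab ac bc !e_neq.
apply: (@induced_free_embedding _ _ _ _ (nth x [:: x; a; b; c]) e_claw_free).
  by move=> i j /eqP; rewrite nth_uniq // => /eqP/val_inj.
case=> [[|[|[|[|?]]]] ?] [[|[|[|[|?]]]] ?] //=; rewrite /claw /=
    ?e_irrefl ?xa ?xb ?xc //;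
  by rewrite e_sym ?xa ?xb ?xc //; apply/negbTE => //; rewrite e_sym.
Qed.

Lemma diamond_tips_adjacent x y c d :
  x != y -> e c d -> e x c -> e x d -> e y c -> e y d -> e x y.
Proof.
move=> xy cd xc xd yc yd; apply/idPn => nxy.
have u : uniq [:: x; y; c; d].
  by rewrite /= !inE !negb_or xy !e_neq.
apply: (@induced_free_embedding _ _ _ _ (nth x [:: x; y; c; d]) e_diamond_free).
  by move=> i j /eqP; rewrite nth_uniq // => /eqP/val_inj.
case=> [[|[|[|[|?]]]] ?] [[|[|[|[|?]]]] ?] //=; rewrite /diamond /=
    ?e_irrefl ?cd ?xc ?xd ?yc ?yd //;
  by rewrite ?(negPf nxy) // e_sym ?(negPf nxy).
Qed.

Definition same_block x y := (x == y) || e x y && [exists w, e x w && e y w].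
Definition block x := [set y | same_block x y].
(** The outside neighbours of a vertex: one for a triangle, none for a [K_4]. *)
Definition out x := [set y | e x y] :\: block x.

Lemma same_block_sym x y : same_block x y = same_block y x.
Proof.
rewrite /same_block eq_sym e_sym; congr (_ || _ && _).
by apply: eq_existsb => w; rewrite andbC.
Qed.

(** Let [w] and [v] complete the edges [xy] and [yz] to triangles.  Since [y]
    has only three neighbours, either one of these triangles contains [x] and [z],
    or [v = w] and both are adjacent to the edge [yw]: no induced diamond then
    makes [x] and [z] adjacent. *)
Lemma same_block_trans x y z : same_block x y -> same_block y z ->
  same_block x z.
Proof.
rewrite /same_block; case: eqP => [->//|_] /= /andP[xy /existsP[w /andP[xw yw]]].
case: eqP => [<- _|_ /= /andP[yz /existsP[v /andP[yv zv]]]].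
  by rewrite xy; apply/orP/or_intror/existsP; exists w; rewrite xw.
have [//|nxz] := eqVneq x z.
suff xz : e x z.
  by rewrite xz /=; apply/existsP; exists y; rewrite -!(e_sym y) e_sym xy.
have [<-//|nwz] := eqVneq w z.
have [exv|nvx] := eqVneq v x; first by rewrite e_sym -exv.
have evw : v = w.
  apply/eqP/idPn => nvw.
  have: [set x; z; v; w] \subset [set u | e y u].
    by apply/subsetP => u; rewrite !inE -!orbA => /or4P[]/eqP->; rewrite // e_sym.
  move/subset_leq_card; rewrite e_cubic.
  rewrite -!setUA !cardsU1 !inE cards1 !negb_or nxz eq_sym nvx (e_neq xw).
  by rewrite (e_neq zv) (eq_sym z) nwz nvw.
subst v; apply: (@diamond_tips_adjacent x z y w) => //; by rewrite e_sym.
Qed.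

Lemma mem_block x y : (y \in block x) = same_block x y.
Proof. by rewrite inE. Qed.

Lemma block_refl x : x \in block x.
Proof. by rewrite inE /same_block eqxx. Qed.

Lemma eq_block x y : (y \in block x) = (block y == block x).
Proof.
apply/idP/eqP => [|<-]; last exact: block_refl.
rewrite inE => xy; apply/setP => z; rewrite !inE.
apply/idP/idP; apply: same_block_trans => //.
by rewrite same_block_sym.
Qed.

Lemma block_adj x y : y \in block x -> x != y -> e x y.
Proof. by rewrite inE => /predU1P[->|/andP[]//]; rewrite eqxx. Qed.

Lemma out_sym x y : (y \in out x) = (x \in out y).
Proof. by rewrite !inE e_sym same_block_sym. Qed.

Lemma card_block_out x : #|block x| + #|out x| = 4.
Proof.
rewrite (cardsD1 x) block_refl -addnA add1n -[in RHS](e_cubic x).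
rewrite -(cardsID (block x) [set y | e x y]) -/(out x).
congr (#|pred_of_set _| + _).+1; apply/setP => y.
rewrite in_setI in_setD1 inE eq_sym.
apply/andP/andP=> [[xy Bxy]|[xy Bxy]]; split => //; first exact: block_adj.
exact: e_neq.
Qed.

(** Without a claw at [x], two of its neighbours are adjacent. *)
Lemma card_block_ge3 x : 3 <= #|block x|.
Proof.
have /card_gt2P[a [b [c [[]]]]] : 2 < #|[set y | e x y]| by rewrite e_cubic.
rewrite !inE => xa xb xc [ab bc]; rewrite eq_sym => ac.
have suff3 u v : e x u -> e x v -> u != v -> e u v -> 2 < #|block x|.
  move=> xu xv nuv uv.
  have: [set x; u; v] \subset block x.
    apply/subsetP => w; rewrite !inE -orbA /same_block => /or3P[]/eqP->.
    - by rewrite eqxx.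
    - by rewrite xu; apply/orP/or_intror/existsP; exists v; rewrite xv.
    - by rewrite xv; apply/orP/or_intror/existsP; exists u; rewrite xu e_sym.
  by move/subset_leq_card; rewrite -setUA !cardsU1 cards1 !inE negb_or !e_neq.
have := neighbours_adjacent xa xb xc; rewrite /= !inE negb_or ab ac bc.
by case/(_ isT)/or3P; apply: suff3.
Qed.

Lemma card_out_le1 x : #|out x| <= 1.
Proof.
by rewrite -(leq_add2l 3) -[3 + 1](card_block_out x) leq_add2r card_block_ge3.
Qed.

Lemma out_uniq x y z : y \in out x -> z \in out x -> y = z.
Proof. by move=> yx zx; apply: (card_le1_eqP (card_out_le1 x)). Qed.

Lemma card_block_out3 x y : y \in out x -> #|block x| = 3.
Proof.
move=> xy; have := card_block_out x.
suff -> : #|out x| = 1 by rewrite addn1 => -[].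
by apply/eqP; rewrite eqn_leq card_out_le1; apply/card_gt0P; exists y.
Qed.

Lemma card_block3_out x : #|block x| = 3 -> exists y, y \in out x.
Proof.
move=> B3; apply/card_gt0P.
by rewrite -(ltn_add2l 3) -{2}B3 card_block_out.
Qed.

Lemma edge_cases x y : e x y -> y \in block x \/ y \in out x.
Proof.
move=> xy; rewrite in_setD [_ \in [set _ | _]]inE xy andbT.
by case: (y \in block x); auto.
Qed.

Lemma block4_edge x y : #|block x| = 4 -> e x y -> y \in block x.
Proof. by move=> B4 /edge_cases[//|/card_block_out3]; rewrite B4. Qed.

Lemma block_choice (P : {set T} -> pred T) :
  (forall x, exists2 z, z \in block x & P (block x) z) ->
  exists s : T -> T, [/\ forall x, s x \in block x,
    forall x y, y \in block x -> s y = s x & forall x, P (block x) (s x)].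
Proof.
move=> exP; pose s x := odflt x [pick z in block x | P (block x) z].
have sP x : s x \in block x /\ P (block x) (s x).
  rewrite /s; case: pickP => [z /andP[]//|none].
  by have [z zx Pz] := exP x; have := none z; rewrite /= zx Pz.
exists s; split=> [x|x y|x]; [by case: (sP x)| |by case: (sP x)].
rewrite eq_block /s => /eqP->; case: pickP => // none.
by have [z zx Pz] := exP x; have := none z; rewrite /= zx Pz.
Qed.

(** * Independent sets of blocks and pointing vertices *)

(** An independent set of the multigraph of blocks, encoded as the union of its
    members. *)
Definition scattered (I : {set T}) :=
  [forall x in I, (block x \subset I) && [disjoint out x & I]].

Lemma scattered_block I x y :
  scattered I -> y \in block x -> (y \in I) = (x \in I).
Proof.
move=> /forall_inP sI yx; apply/idP/idP => /sI /andP[/subsetP sub _]; last exact: sub.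
by apply: sub; rewrite eq_block eq_sym -eq_block.
Qed.

Lemma scattered_out I x y : scattered I -> x \in I -> y \in out x -> y \notin I.
Proof. by move=> /forall_inP sI /sI /andP[_ dis] /(disjointFr dis)->. Qed.

(** Take [I] maximal.  If no edge leaves the block of [x] towards [I], then the
    block can be added to [I]. *)
Lemma dominating_scattered :
  exists2 I, scattered I & forall x, x \notin I ->
    exists z y, [/\ z \in block x, y \in out z & y \in I].
Proof.
have [I /maxsetP[sI maxI] _] :
    {I : {set T} | maxset scattered I & set0 \subset I}.
  by apply: maxset_exists; apply/forall_inP => x; rewrite inE.
exists I => // x nIx.
have [/existsP[z /existsP[y /and3P]]|none] :=
    boolP [exists z, exists y, [&& z \in block x, y \in out z & y \in I]].
  by exists z, y.
have nope z y : z \in block x -> y \in out z -> y \notin I.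
  move=> zx yz; apply: contra none => Iy; apply/existsP; exists z.
  by apply/existsP; exists y; apply/and3P.
suff sB : scattered (block x :|: I).
  by move: nIx; rewrite -(maxI _ sB (subsetUr _ _)) in_setU block_refl.
apply/forall_inP => z; rewrite in_setU => /orP[zx|Iz]; apply/andP; split.
- by move: zx; rewrite eq_block => /eqP->; apply: subsetUl.
- rewrite disjoint_subset; apply/subsetP => y yz.
  rewrite inE in_setU negb_or (nope z y zx yz) andbT.
  by move: zx yz; rewrite in_setD eq_block => /eqP-> /andP[].
- case/forall_inP/(_ z Iz)/andP: sI => sub _.
  exact: subset_trans sub (subsetUr _ _).
- rewrite disjoint_subset; apply/subsetP => y yz.
  rewrite inE in_setU negb_or (scattered_out sI Iz yz) andbT.
  by apply/negP => yx; have := nope y z yx; rewrite -out_sym yz Iz => /(_ isT).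
Qed.

(** [f] sends a block to the block it points to.  A triangle receives at most
    three of the edges leaving a family of triangles in [I], one through each
    of its vertices, hence Hall's condition; [m] follows these edges.  A block
    [K_4] has no outside edge, so only the triangles enter Hall's theorem. *)
Lemma distinct_targets I : scattered I ->
  exists f : {set T} -> option {set T},
    (forall x, x \in I -> exists2 z, z \in block x &
       forall y, y \in out z -> f (block x) = Some (block y)) /\
    (forall x y u v, x \in I -> y \in I -> u \in out x -> v \in out y ->
       f (block x) = f (block y) -> block x = block y).
Proof.
move=> sI.
pose X := [set block x | x in [set x in I | #|block x| == 3]].
pose F (B : {set T}) := [set block y | y in \bigcup_(x in B) out x].
have XP B : B \in X -> exists2 x, x \in I & B = block x /\ #|block x| = 3.
  by case/imsetP=> x; rewrite inE => /andP[Ix /eqP B3] ->; exists x.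
have [A sAX|f fF f_inj] := @Hall_marriage _ _ X F.
  set Y := \bigcup_(B in A) F B.
  have tA : trivIset A.
    apply/trivIsetP => B B' /(subsetP sAX)/XP[x _ [-> _]].
    move=> /(subsetP sAX)/XP[y _ [-> _]].
    apply: contraR => /pred0Pn[z /= /andP[]].
    by rewrite !eq_block => /eqP->.
  have cA : #|cover A| = #|A| * 3.
    rewrite -(eqP tA) -sum_nat_const; apply: eq_bigr => B.
    by case/(subsetP sAX)/XP => x _ [->].
  have cY : #|cover Y| <= #|Y| * 3.
    apply: leq_trans (leq_card_cover _) _.
    rewrite -sum_nat_const; apply: leq_sum => B.
    case/bigcupP => B1 _ /imsetP[y /bigcupP[x _ yx] ->].
    by rewrite (@card_block_out3 y x) // out_sym.
  rewrite -(@leq_pmul2r 3) // -cA; apply: leq_trans cY.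
  pose m x := odflt x [pick y in out x].
  have mP x : x \in cover A -> m x \in out x.
    case/bigcupP => B AB Bx; rewrite /m; case: pickP => // out0.
    have [x' _ [eB B3]] := XP _ (subsetP sAX _ AB).
    move: Bx; rewrite eB eq_block => /eqP eBx; rewrite -eBx in B3.
    by have [y] := card_block3_out B3; rewrite out0.
  rewrite -(@card_in_imset _ _ m) => [|x x' /mP mx /mP mx' emx].
    apply/subset_leq_card/subsetP => _ /imsetP[x Ax ->].
    apply/bigcupP; exists (block (m x)); last exact: block_refl.
    have [B AB Bx] := bigcupP Ax; apply/bigcupP; exists B => //.
    by apply: imset_f; apply/bigcupP; exists x; rewrite ?mP.
  by apply: (@out_uniq (m x)); rewrite out_sym // emx.
exists f; split=> [x Ix|x y u v Ix Iy ux vy].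
  have [B3|B3] := eqVneq #|block x| 3.
    have [|B' fB /imsetP[w /bigcupP[z zx wz] def_y]] := fF (block x).
      by apply: imset_f; rewrite inE Ix B3 /=.
    by exists z => // y yz; rewrite fB def_y (out_uniq wz yz).
  exists x => [|y /card_block_out3 /eqP]; first exact: block_refl.
  by rewrite (negPf B3).
by apply: f_inj; apply: imset_f;
  rewrite inE ?Ix ?Iy /= ?(card_block_out3 ux) ?(card_block_out3 vy).
Qed.

(** A function [s] on vertices that is constant on blocks selects one vertex per
    block: outside [I], a vertex joined to [I]; in [I], a vertex joined to the
    block chosen by [distinct_targets].  Since a vertex has at most one outside
    neighbour, both requirements may be put on all its outside neighbours,
    which makes them vacuous in a [K_4]. *)
Lemma pointing_vertices I : scattered I ->
  (forall x, x \notin I ->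
    exists z y, [/\ z \in block x, y \in out z & y \in I]) ->
  exists s : T -> T, [/\ forall x, s x \in block x,
    forall x y, y \in block x -> s y = s x,
    forall x y, x \notin I -> y \in out (s x) -> y \in I &
    forall x y u v, x \in I -> y \in I -> u \in out (s x) -> v \in out (s y) ->
      block u = block v -> block x = block y].
Proof.
move=> sI domI; have [f [fP f_inj]] := distinct_targets sI.
have blockI x : (block x \subset I) = (x \in I).
  apply/subsetP/idP => [sub|Ix y yx]; first exact/sub/block_refl.
  by rewrite (scattered_block sI yx).
pose good (B : {set T}) z := if B \subset I
  then [forall y in out z, f B == Some (block y)] else out z \subset I.
have [|s [s_block s_const s_good]] := @block_choice good.
  move=> x; rewrite /good blockI.
  have [Ix|/domI[z [y [zx yz Iy]]]] := boolP (x \in I).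
    have [z zx fz] := fP x Ix; exists z => //.
    by apply/forall_inP => y /fz->.
  by exists z => //; apply/subsetP => y' /(out_uniq yz)<-.
have s_target x u : x \in I -> u \in out (s x) -> f (block x) = Some (block u).
  move=> Ix xu; have := s_good x; rewrite /good blockI Ix.
  by move/forall_inP/(_ u xu)/eqP.
exists s; split=> // [x y nIx xy|x y u v Ix Iy xu yv eq_uv].
  have := s_good x; rewrite /good blockI (negPf nIx) => /subsetP; exact.
have eBs z : block (s z) = block z by apply/eqP; rewrite -eq_block.
have sxI z : z \in I -> s z \in I by rewrite (scattered_block sI (s_block z)).
have := f_inj _ _ _ _ (sxI x Ix) (sxI y Iy) xu yv; rewrite !eBs; apply.
by rewrite (s_target x u Ix xu) (s_target y v Iy yv) eq_uv.
Qed.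

(** A second selection, used in the blocks [K_4], where two vertices must be
    coloured with [C] and [D]. *)
Lemma second_vertices (s : T -> T) :
  (forall x, s x \in block x) -> (forall x y, y \in block x -> s y = s x) ->
  exists t : T -> T, [/\ forall x, t x \in block x,
    forall x y, y \in block x -> t y = t x & forall x, s x != t x].
Proof.
move=> s_block s_const.
have [|t [t_block t_const t_neq]] :=
    @block_choice (fun B z => [forall y in B, s y != z]).
  move=> x; have : 0 < #|block x :\ s x|.
    by have := card_block_ge3 x; rewrite (cardsD1 (s x)) s_block; case: #|_|.
  case/card_gt0P => z; rewrite in_setD1 => /andP[nz zx]; exists z => //.
  by apply/forall_inP => y /s_const->; rewrite eq_sym.
exists t; split=> // x.
by have /forall_inP/(_ x (block_refl x)) := t_neq x.
Qed.

(** * The packing colouring *)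

Section Colouring.

Context (I : {set T}) (sI : scattered I).
Context (domI : forall x, x \notin I ->
  exists z y, [/\ z \in block x, y \in out z & y \in I]).
Context (s t : T -> T).
Context (s_block : forall x, s x \in block x)
  (s_const : forall x y, y \in block x -> s y = s x).
Context (s_out : forall x y, x \notin I -> y \in out (s x) -> y \in I).
Context (s_target : forall x y u v, x \in I -> y \in I ->
  u \in out (s x) -> v \in out (s y) -> block u = block v -> block x = block y).
Context (t_block : forall x, t x \in block x)
  (t_const : forall x y, y \in block x -> t y = t x).
Context (t_neq : forall x, s x != t x).

Let D := [set x in I | s x == x].
Let C := [set x | (s x == x) && (x \notin I)
               || (#|block x| == 4) && (t x == x)].

(** A block [K_4] outside [I] would need an outside edge towards [I]. *)
Lemma block4_I x : #|block x| = 4 -> x \in I.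
Proof.
move=> B4; apply/idPn => /domI[z [y [zx yz _]]].
move: zx; rewrite eq_block => /eqP eB.
by have := card_block_out3 yz; rewrite eB B4.
Qed.

Lemma same_blockE x y : x \in block y ->
  (s x = s y) * (t x = t y) * (block x = block y).
Proof.
move=> xy; rewrite (s_const xy) (t_const xy).
by move: xy; rewrite eq_block => /eqP.
Qed.

Lemma block_sym x y : x \in block y -> y \in block x.
Proof. by rewrite !mem_block same_block_sym. Qed.

Lemma disjoint_CD : [disjoint C & D].
Proof.
rewrite disjoints_subset; apply/subsetP => x; rewrite !inE.
case/orP=> [/andP[_ /negPf->]//|/andP[_ /eqP tx]].
by have := t_neq x; rewrite tx => /negPf->; rewrite andbF.
Qed.

Lemma s_coloured x : s x \in C :|: D.
Proof.
have ss : s (s x) == s x by apply/eqP/s_const.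
by rewrite !inE ss /=; case: (s x \in I); rewrite ?orbT.
Qed.

Lemma t_coloured x : #|block x| = 4 -> t x \in C :|: D.
Proof.
move=> B4; have eB := same_blockE (t_block x).
by rewrite !inE !eB B4 !eqxx !orbT.
Qed.

(** A triangle has only two vertices other than [s x], and a [K_4] only two
    other than [s x] and [t x]. *)
Lemma uncoloured_mate_uniq x y z :
  [&& x \notin C :|: D, y \notin C :|: D, x != y & y \in block x] ->
  [&& x \notin C :|: D, z \notin C :|: D, x != z & z \in block x] -> y = z.
Proof.
case/and4P=> rx ry xy yx /and4P[_ rz xz zx]; apply/eqP/idPn => yz.
have snot u : u \notin C :|: D -> s x != u.
  by apply: contraNneq => <-; apply: s_coloured.
have sub : [set s x; x; y; z] \subset block x.
  apply/subsetP => u; rewrite !in_setU !in_set1 -!orbA.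
  by case/or4P=> /eqP->; rewrite ?block_refl.
have c4 : #|[set s x; x; y; z]| = 4.
  by rewrite -!setUA !cardsU1 cards1 !inE !negb_or !snot // xy xz yz.
have B4 : #|block x| = 4.
  apply/eqP; rewrite eqn_leq -{2}c4 subset_leq_card // andbT.
  by rewrite -[leqRHS](card_block_out x) leq_addr.
have eB : [set s x; x; y; z] = block x by apply/eqP; rewrite eqEcard sub c4 B4.
have tnot u : u \notin C :|: D -> (t x == u) = false.
  by move=> ru; apply/negbTE; apply: contraNneq ru => <-; apply: t_coloured.
have := t_block x; rewrite -eB !in_setU !in_set1.
rewrite (tnot x) // (tnot y) // (tnot z) // !orbF eq_sym.
by rewrite (negPf (t_neq x)).
Qed.

Lemma uncoloured_2colorable : exists A : {set T}, forall x y,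
  x \notin C :|: D -> y \notin C :|: D -> e x y -> (y \in A) = (x \notin A).
Proof.
pose p x y := [&& x \notin C :|: D, y \notin C :|: D, x != y & y \in block x].
pose q x y := y \in out x.
have [||||||A colA] := @two_matchings_2colorable _ p q.
- by move=> x y; rewrite /p andbCA (eq_sym x) !mem_block (same_block_sym x).
- by move=> x y; rewrite /q out_sym.
- by move=> x; rewrite /p eqxx !andbF.
- by move=> x; rewrite /q in_setD block_refl.
- exact: uncoloured_mate_uniq.
- exact: out_uniq.
exists A => x y rx ry xy; apply: colA; rewrite /p /q rx ry e_neq //=.
by apply/orP; apply: edge_cases.
Qed.

Lemma C_cases u : u \in C ->
  (u \notin I /\ s u = u) \/ (#|block u| = 4 /\ t u = u).
Proof.
by rewrite inE => /orP[/andP[/eqP su nIu]|/andP[/eqP B4 /eqP tu]]; [left|right].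
Qed.

Lemma C_block_uniq u v : u \in C -> v \in C -> u \in block v -> u = v.
Proof.
move=> uC vC uv; move: (C_cases uC) (C_cases vC).
rewrite (scattered_block sI uv) !(same_blockE uv).
move=> [[nIv su]|[B4 tu]] [[nIv' sv]|[B4' tv]]; first by rewrite -su sv.
- by rewrite (block4_I B4') in nIv.
- by rewrite (block4_I B4) in nIv'.
- by rewrite -tu tv.
Qed.

Lemma D_block_uniq u v : u \in D -> v \in D -> u \in block v -> u = v.
Proof.
move=> uD vD /same_blockE uv; move: uD vD.
rewrite !inE => /andP[_ /eqP su] /andP[_ /eqP sv].
by rewrite -su uv sv.
Qed.

Lemma block4_far x y : #|block x| = 4 -> y \notin block x ->
  ~~ e x y /\ forall z, e x z -> ~~ e z y.
Proof.
move=> B4 nyx; split=> [|z /(block4_edge B4) zx]; apply: contra nyx.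
  exact: block4_edge.
by rewrite -(same_blockE zx); apply: block4_edge; rewrite (same_blockE zx).
Qed.

(** A [K_4] is a whole component.  In a triangle, a vertex of [C] has its
    outside neighbour in [I] and its block disjoint from [I].  A path of length
    at most 2 between two such vertices in distinct blocks either is made of
    their two outside edges, and its middle vertex has two outside neighbours,
    or uses the outside edge of one of them to enter the block of the other,
    which is not in [I]. *)
Lemma C_packing : packing e 2 C.
Proof.
apply: packing2I => u v Cu Cv uv.
have nvu : v \notin block u by apply: contra uv => /(C_block_uniq Cv Cu)->.
have nuv : u \notin block v by apply: contra nvu; apply: block_sym.
have [[nIu su]|[B4 _]] := C_cases Cu; last exact: block4_far.
have [[nIv sv]|[B4 _]] := C_cases Cv; last first.
  have [nadj no_path] := block4_far B4 nuv; split; first by rewrite e_sym.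
  move=> z uz; apply/negP => zv; have := no_path z.
  by rewrite e_sym zv e_sym uz => /(_ isT).
have outI x y : x \notin I -> s x = x -> y \in out x -> y \in I.
  by move=> nIx sx xy; apply: (s_out nIx); rewrite sx.
split=> [|z /edge_cases[uz|uz]]; apply/negP => /edge_cases[zv|zv].
- by rewrite zv in nvu.
- by have := outI u v nIu su zv; rewrite (negPf nIv).
- by case/negP: nvu; rewrite -(same_blockE uz).
- have := outI v z nIv sv; rewrite out_sym => /(_ zv).
  by rewrite (scattered_block sI uz) (negPf nIu).
- by have := outI u z nIu su uz; rewrite -(scattered_block sI zv) (negPf nIv).
- by case/eqP: uv; apply: (@out_uniq z); rewrite // out_sym.
Qed.

(** A path of length 2 that leaves a block of [I] reaches a vertex outside [I],
    whose only outside neighbour is the one it came from. *)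
Lemma scattered_path2 u v z :
  u \in I -> v \in I -> e u z -> e z v -> u \in block v.
Proof.
move=> Iu Iv /edge_cases[uz|uz] /edge_cases[zv|zv].
- by apply: block_sym; move: uz zv; rewrite !eq_block => /eqP->.
- have := scattered_out sI _ zv.
  by rewrite Iv (scattered_block sI uz) Iu => /(_ isT).
- by have := scattered_out sI Iu uz; rewrite -(scattered_block sI zv) Iv.
- by rewrite (@out_uniq z u v) ?block_refl // out_sym.
Qed.

(** By [scattered_path2], a path [u z w v] of length 3 between distinct blocks
    of [I] must leave both by an outside edge.  As [u] is the only outside
    neighbour of [z], the edge [zw] lies in a block, to which [u] and [v] both
    point. *)
Lemma D_packing : packing e 3 D.
Proof.
apply: packing3I => u v Du Dv uv.
have nuv : u \notin block v by apply: contra uv => /(D_block_uniq Du Dv)->.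
have [/andP[Iu /eqP su] /andP[Iv /eqP sv]] :
    (u \in I) && (s u == u) /\ (v \in I) && (s v == v).
  by move: Du Dv; rewrite !inE.
split=> [|z uz|z w uz zw].
- apply/negP => /edge_cases[/block_sym|]; first exact/negP.
  by move/(scattered_out sI Iu); rewrite Iv.
- by apply: contra nuv; apply: scattered_path2.
apply: contra nuv => wv.
have [uzB|uzO] := edge_cases uz.
  have Iz : z \in I by rewrite (scattered_block sI uzB).
  by rewrite eq_block -(same_blockE uzB) -eq_block (@scattered_path2 z v w).
have [wvB|wvO] := edge_cases wv.
  have Iw : w \in I by rewrite -(scattered_block sI wvB).
  by rewrite (same_blockE wvB) (@scattered_path2 u w z).
have [zwB|zwO] := edge_cases zw.
  rewrite out_sym in wvO; rewrite eq_block.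
  by rewrite (s_target Iu Iv (u := z) (v := w)) ?su ?sv // (same_blockE zwB).
(* [z] has a single outside neighbour, so the path comes back to [u] *)
have wu : w = u by apply: (@out_uniq z); rewrite // out_sym.
by have := scattered_out sI Iu; move=> /(_ v); rewrite -wu wvO Iv => /(_ isT).
Qed.

Lemma colouring_of_pointers : packing_colorable_1123 e.
Proof.
have [A colA] := uncoloured_2colorable.
have indep (B : {set T}) : {in B &, forall x y, (y \in A) = (x \in A)} ->
    independent e (B :\: (C :|: D)).
  move=> hB x y; rewrite !in_setD => /andP[rx Bx] /andP[ry By].
  apply/negP => /(colA x y rx ry).
  by rewrite (hB x y) //; case: (x \in A).
exists (A :\: (C :|: D)), (~: A :\: (C :|: D)), C, D; split.
  exact: partition4_split disjoint_CD.
split; [| |exact: C_packing|exact: D_packing].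
- by apply: indep => x y -> ->.
- by apply: indep => x y; rewrite !inE => /negPf-> /negPf->.
Qed.

End Colouring.

Lemma block_colouring : packing_colorable_1123 e.
Proof.
have [I sI domI] := dominating_scattered.
have [s [s_block s_const s_out s_target]] := pointing_vertices sI domI.
have [t [t_block t_const t_neq]] := second_vertices s_block s_const.
exact: (colouring_of_pointers sI domI s_block s_const s_out s_target
          t_block t_const t_neq).
Qed.

End ClawDiamondFreeCubic.

Theorem theorem4 (T : finType) (e : rel T)
    (e_sym : symmetric e) (e_irrefl : irreflexive e)
    (e_cubic : cubic e) (e_claw_free : claw_free e)
    (e_diamond_free : diamond_free e) :
  packing_colorable_1123 e.
Proof. exact: block_colouring. Qed.
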